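(* Let $f:\mathbb{R}^2\to\mathbb{R}$ be a smooth Morse function, let $G=\|\nabla f\|$ be its gradient magnitude field, and let $\delta>0$. Let $X$ be a bounded, simply connected, connected component of the $\delta$-sublevel set $G^{-1}(-\infty,\delta]$, regarded as a region of the plane: assume $\|\nabla f\|\le\delta$ on $\overline{X}$, $\|\nabla f\|=\delta$ on the boundary $\mathrm{Bd}(X)$, and $\mathrm{Bd}(X)$ is a Jordan curve. Suppose the degree of $X$ is non-zero. Then there exists a continuous vector field $\widetilde{V}:\overline{X}\to\mathbb{R}^2$ such that: (i) $\widetilde V$ is a $2\delta$-perturbation of $\nabla f|_{\overline{X}}$, i.e. $\sup_{p\in\overline{X}}\|\widetilde V(p)-\nabla f(p)\|\le 2\delta$; (ii) $\widetilde V|_{\mathrm{Bd}(X)}=\nabla f|_{\mathrm{Bd}(X)}$; (iii) $\widetilde V$ has exactly one zero (singularity) in $\overline{X}$.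
   Context: The degree of $X$ is the sum of the Poincaré indices of the zeros of the gradient vector field $\nabla f$ contained in $X$ (the zeros of $\nabla f$ are the critical points of $f$; they are isolated since $f$ is Morse; sources and sinks have index $+1$, saddles have index $-1$). A singularity of a vector field is a point where it vanishes. For vector fields $V,\widetilde V$ on a common domain, $\widetilde V$ is called a $\delta$-perturbation of $V$ if $\sup_p\|V(p)-\widetilde V(p)\|\le\delta$. *)

(* Defs.v *)
(* the plane R^2 is modeled as R * R over R : realType
   (product topology = Euclidean topology); Euclidean norm defined explicitly. *)
From HB Require Import structures.
From mathcomp Require Import all_boot all_order all_algebra.
From mathcomp Require Import all_classical all_reals all_analysis.
Set Implicit Arguments. Unset Strict Implicit. Unset Printing Implicit Defensive.
Import Order.TTheory GRing.Theory Num.Theory.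
Import numFieldNormedType.Exports.
Local Open Scope classical_set_scope.
Local Open Scope ring_scope.

Section Plane.
Variable R : realType.
Notation P := (R * R)%type.

Definition enorm (u : P) : R := Num.sqrt (u.1 ^+ 2 + u.2 ^+ 2).
Definition dist2 (u v : P) : R := enorm (u.1 - v.1, u.2 - v.2).

Definition dx (g : P -> R) : P -> R := fun p => derive1 (fun t => g (t, p.2)) p.1.
Definition dy (g : P -> R) : P -> R := fun p => derive1 (fun t => g (p.1, t)) p.2.

Definition pd (b : bool) (g : P -> R) : P -> R := if b then dx g else dy g.
Definition iterD (ds : seq bool) (g : P -> R) : P -> R := foldr pd g ds.

Definition smooth (g : P -> R) : Prop :=
  forall ds : seq bool,
    continuous (iterD ds g) /\
    forall p : P, derivable (fun t => iterD ds g (t, p.2)) p.1 1 /\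
                  derivable (fun t => iterD ds g (p.1, t)) p.2 1.

Definition grad (g : P -> R) : P -> P := fun p => (dx g p, dy g p).
Definition critical (g : P -> R) (p : P) : Prop := grad g p = (0, 0).

Definition hessdet (g : P -> R) (p : P) : R :=
  dx (dx g) p * dy (dy g) p - dx (dy g) p * dy (dx g) p.

Definition morse (g : P -> R) : Prop :=
  forall p, critical g p -> hessdet g p != 0.

(* Poincare index of a (nondegenerate) zero of grad g: sources and sinks
   (local minima / maxima, Hessian determinant > 0) have index +1,
   saddles (Hessian determinant < 0) have index -1. *)
Definition pindex (g : P -> R) (p : P) : int :=
  if 0 < hessdet g p then (1 : int) else (-1 : int).

(* degree of X: sum of Poincare indices of the zeros of grad g in X
   (finitely supported sum; the set of critical points in X is finite
   when g is Morse and X is compact). *)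
Definition degree (g : P -> R) (X : set P) : int :=
  (\sum_(p \in X `&` critical g) pindex g p)%R.

Definition boundary (X : set P) : set P := closure X `\` interior X.

Definition I01 : set R := [set t | 0 <= t <= 1].
Definition square01 : set P := [set q | 0 <= q.1 <= 1 /\ 0 <= q.2 <= 1].

Definition bounded_plane (X : set P) : Prop :=
  exists M : R, forall p, X p -> enorm p <= M.

Definition path_connected_plane (X : set P) : Prop :=
  forall a b, X a -> X b -> exists g : R -> P,
    {within I01, continuous g} /\ (forall t, I01 t -> X (g t)) /\
    g 0 = a /\ g 1 = b.

Definition simply_connected_plane (X : set P) : Prop :=
  path_connected_plane X /\
  forall g : R -> P, {within I01, continuous g} -> (forall t, I01 t -> X (g t)) ->
    g 0 = g 1 ->
    exists H : P -> P,
      {within square01, continuous H} /\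
      (forall q, square01 q -> X (H q)) /\
      (forall t, I01 t -> H (0, t) = g t) /\
      (forall t, I01 t -> H (1, t) = H (1, 0)) /\
      (forall s, I01 s -> H (s, 0) = H (s, 1)).

Definition jordan_curve (C : set P) : Prop :=
  exists g : R -> P,
    {within I01, continuous g} /\ g 0 = g 1 /\
    (forall s t, 0 <= s < 1 -> 0 <= t < 1 -> g s = g t -> s = t) /\
    C = g @` I01.

End Plane.

(* Main.v *)
(* On the boundary C of X the field grad f has constant norm delta, so it is
   enough to extend its direction grad f / delta from C to X minus one point, with
   values in the unit circle: multiplied by a factor that goes from delta to 0 at
   that point, the extension has norm at most delta, hence is within 2 delta of
   grad f. Since the degree is nonzero, X contains a critical point, and only
   finitely many. Around a critical point q the direction of grad f turns k times
   for some integer k; divided by the k-th power of the direction field of x - q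
   it extends over a disc around q. Two points p and q of the interior of X have
   the same winding number with respect to C, because otherwise a suitable product
   of powers of the two direction fields would extend to a map from the plane to
   the circle of nonzero degree at infinity. Hence x - q can be replaced by x - p
   up to a factor which has a continuous logarithm on C, and all the critical points
   are moved to a single one. *)
Require Import Defs.
From HB Require Import structures.
From mathcomp Require Import all_boot all_order all_algebra.
From mathcomp Require Import all_classical all_reals all_analysis.
From mathcomp Require Import ring lra zify.
Set Implicit Arguments.
Unset Strict Implicit.
Unset Printing Implicit Defensive.
Import Order.TTheory GRing.Theory Num.Theory.
Import numFieldNormedType.Exports.
Local Open Scope classical_set_scope.
Local Open Scope ring_scope.

(** * The unit circle *)

Section Circle.
Variable R : realType.
Notation P := (R * R)%type.
Implicit Types (u v p q : P) (s t : R).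

Definition cis t : P := (cos t, sin t).
Definition cmul u v : P := (u.1 * v.1 - u.2 * v.2, u.1 * v.2 + u.2 * v.1).
Definition cconj u : P := (u.1, - u.2).
(** On the unit circle the conjugate is the inverse, so negative exponents give inverse powers
    there. *)
Definition cpow u (k : int) : P :=
  match k with
  | Posz n => iter n (cmul u) (1, 0)
  | Negz n => iter n.+1 (cmul (cconj u)) (1, 0)
  end.
Definition on_circle u : Prop := u.1 ^+ 2 + u.2 ^+ 2 = 1.

Lemma cis_on_circle t : on_circle (cis t).
Proof. exact: cos2Dsin2. Qed.

Lemma cis0 : cis 0 = (1, 0).
Proof. by rewrite /cis cos0 sin0. Qed.

Lemma cmul_cis s t : cmul (cis s) (cis t) = cis (s + t).
Proof. by rewrite /cmul /cis /= cosD sinD [in RHS]addrC; congr (_, _); ring. Qed.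

Lemma cconj_cis t : cconj (cis t) = cis (- t).
Proof. by rewrite /cconj /cis cosN sinN. Qed.

Lemma cpow_cis t k : cpow (cis t) k = cis (k%:~R * t).
Proof.
have iterE s n : iter n (cmul (cis s)) (1, 0) = cis (n%:R * s).
  elim: n => [|n IH]; first by rewrite mul0r cis0.
  by rewrite iterS IH cmul_cis -natr1; congr cis; ring.
case: k => n; rewrite /cpow ?cconj_cis iterE; congr cis.
  by rewrite NegzE mulrNz /=; ring.
Qed.

(** Reduces identities between products, conjugates and powers of unit vectors to sums of angles.
    [acos] reaches the upper half circle, its negative the lower one. *)
Lemma circle_cis u : on_circle u -> exists t, u = cis t.
Proof.
case: u => c s; rewrite /on_circle /= => h.
have c1 : -1 <= c <= 1 by nra.
have hs : Num.sqrt (1 - c ^+ 2) = `|s| by rewrite -h addrC addKr sqrtr_sqr.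
have [s0|s0] := leP 0 s.
  by exists (acos c); rewrite /cis sin_acos // acosK ?in_itv // hs ger0_norm.
exists (- acos c); rewrite /cis cosN sinN sin_acos // acosK ?in_itv // hs.
by rewrite ltr0_norm // opprK.
Qed.

Lemma on_circle_cmul u v : on_circle u -> on_circle v -> on_circle (cmul u v).
Proof.
move=> /circle_cis[s ->] /circle_cis[t ->].
by rewrite cmul_cis; exact: cis_on_circle.
Qed.

Lemma on_circle_cconj u : on_circle u -> on_circle (cconj u).
Proof. by move=> /circle_cis[s ->]; rewrite cconj_cis; exact: cis_on_circle. Qed.

Lemma on_circle_cpow u k : on_circle u -> on_circle (cpow u k).
Proof. by move=> /circle_cis[s ->]; rewrite cpow_cis; exact: cis_on_circle. Qed.

(* The principal argument; the denominator is truncated to make it continuous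
   on the whole plane. *)
Definition parg u : R := atan (u.2 / Num.max u.1 2^-1).

Lemma cis_parg u : on_circle u -> 2^-1 <= u.1 -> cis (parg u) = u.
Proof.
case: u => c s; rewrite /on_circle /parg /= => h c2.
have c0 : 0 < c by lra.
rewrite max_l //.
have cosE : cos (atan (s / c)) = c.
  rewrite cos_atan.
  have -> : 1 + (s / c) ^+ 2 = (c^-1) ^+ 2.
    rewrite expr_div_n -[X in X + _](divff (lt0r_neq0 (exprn_gt0 2 c0))).
    by rewrite -mulrDl h mul1r exprVn.
  by rewrite sqrtr_sqr ger0_norm ?invrK // invr_ge0 ltW.
have /eqP cn0 : cos (atan (s / c)) <> 0 by rewrite cosE; lra.
have := @atanK R (s / c); rewrite /tan => /(congr1 ( *%R^~ (cos (atan (s / c))))).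
rewrite divfK // cosE divfK ?gt_eqF // => sinE.
by rewrite /cis sinE cosE.
Qed.

Lemma cisD2pi t (k : int) : cis (t + k%:~R * (2 * pi)) = cis t.
Proof.
have c1 : cis (2 * pi) = cis 0.
  by rewrite cis0 /cis -[2]/(2%:R) mulr_natl cos2pi sin2pi.
rewrite -cmul_cis -cpow_cis c1 cpow_cis mulr0 cmul_cis.
by rewrite addr0.
Qed.

(** Removing whole turns leaves an angle [r] in [0, 2 pi) with cosine 1. Cosine is injective on
    [0, pi], which gives [r = 0]; beyond pi, the same argument for [2 * pi - r] contradicts
    [r < 2 * pi]. *)
Lemma cis_eq_2pi s t : cis s = cis t -> exists k : int, s = t + k%:~R * (2 * pi).
Proof.
move=> st; have pi0 := @pi_gt0 R.
pose k := Num.floor ((s - t) / (2 * pi)); exists k.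
pose r := s - t - k%:~R * (2 * pi).
have cr : cos r = 1.
  suff [] : cis r = cis 0 by rewrite cos0.
  have -> : r = s + (- t) + (- k)%:~R * (2 * pi) by rewrite /r mulrNz; ring.
  by rewrite cisD2pi -cmul_cis st cmul_cis subrr.
have r0 : 0 <= r.
  by rewrite subr_ge0 -ler_pdivlMr ?floor_le //; lra.
have r2 : r < 2 * pi.
  have := floorD1_gt ((s - t) / (2 * pi)).
  by rewrite ltr_pdivrMr ?intrD -/k /r; lra.
suff : r = 0 by rewrite /r; lra.
have [rpi|rpi] := leP r pi.
  by apply: cos_inj; rewrite ?in_itv /= ?cr ?cos0 //; apply/andP; split; lra.
have : 2 * pi - r = 0; last by lra.
apply: cos_inj; rewrite ?in_itv /=; try (by apply/andP; split; lra).
rewrite cos0 -[RHS]cr; have [-> _] : cis (2 * pi - r) = cis (- r).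
  by rewrite -[RHS](cisD2pi _ 1) addrC mul1r.
by rewrite cosN.
Qed.

Section Continuity.
Variable T : topologicalType.
Implicit Types (a : T) (f g : T -> P) (h : T -> R).

Lemma continuous_at_pair (h1 h2 : T -> R) a :
  {for a, continuous h1} -> {for a, continuous h2} ->
  {for a, continuous (fun x => (h1 x, h2 x) : P)}.
Proof. by move=> c1 c2; exact: cvg_pair c1 c2. Qed.

Lemma continuous_at_fst f a : {for a, continuous f} ->
  {for a, continuous (fun x => (f x).1 : R)}.
Proof. by move=> cf; apply: (continuous_comp cf); exact: cvg_fst. Qed.

Lemma continuous_at_snd f a : {for a, continuous f} ->
  {for a, continuous (fun x => (f x).2 : R)}.
Proof. by move=> cf; apply: (continuous_comp cf); exact: cvg_snd. Qed.

Lemma continuous_at_cmul f g a : {for a, continuous f} -> {for a, continuous g} ->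
  {for a, continuous (fun x => cmul (f x) (g x))}.
Proof.
move=> cf cg.
have [f1 f2] := (continuous_at_fst cf, continuous_at_snd cf).
have [g1 g2] := (continuous_at_fst cg, continuous_at_snd cg).
apply: continuous_at_pair.
  by apply: cvgB; apply: cvgM.
by apply: cvgD; apply: cvgM.
Qed.

Lemma continuous_at_cconj f a : {for a, continuous f} ->
  {for a, continuous (fun x => cconj (f x))}.
Proof.
move=> cf; apply: continuous_at_pair; first exact: continuous_at_fst.
by apply: cvgN; exact: continuous_at_snd.
Qed.

Lemma continuous_at_cpow f k a : {for a, continuous f} ->
  {for a, continuous (fun x => cpow (f x) k)}.
Proof.
have iterC g n : {for a, continuous g} ->
    {for a, continuous (fun x => iter n (cmul (g x)) (1, 0))}.
  move=> cg; elim: n => [|n IH] /=; first exact: cvg_cst.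
  exact: continuous_at_cmul.
by move=> cf; case: k => n; apply: iterC => //; exact: continuous_at_cconj.
Qed.

Lemma continuous_at_cis h a : {for a, continuous h} ->
  {for a, continuous (fun x => cis (h x))}.
Proof.
move=> ch; apply: continuous_at_pair.
  by apply: (continuous_comp ch); exact: continuous_cos.
by apply: (continuous_comp ch); exact: continuous_sin.
Qed.

Lemma continuous_at_enorm f a : {for a, continuous f} ->
  {for a, continuous (fun x => enorm (f x))}.
Proof.
move=> cf; rewrite /enorm.
have [f1 f2] := (continuous_at_fst cf, continuous_at_snd cf).
have cc : {for a, continuous (fun x => (f x).1 ^+ 2 + (f x).2 ^+ 2)}.
  by apply: cvgD; rewrite expr2; apply: cvgM.
by apply: (continuous_comp cc); exact: sqrt_continuous.
Qed.

Lemma continuous_at_parg f a : {for a, continuous f} ->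
  {for a, continuous (fun x => parg (f x))}.
Proof.
move=> cf; rewrite /parg.
have [f1 f2] := (continuous_at_fst cf, continuous_at_snd cf).
have cc : {for a, continuous (fun x => (f x).2 / Num.max (f x).1 2^-1)}.
  apply: cvgM => //; apply: cvgV.
    by rewrite gt_eqF // lt_max; apply/orP; right; lra.
  apply: (@continuous_max R T (fun x => (f x).1) (cst 2^-1)) => //.
  exact: cvg_cst.
by apply: (continuous_comp cc); exact: continuous_atan.
Qed.

End Continuity.
End Circle.

(** * Lifting maps to the circle *)

Lemma within_comp (T U W : topologicalType) (A : set U) (g : T -> U) (u : U -> W) :
  {within A, continuous u} -> continuous g -> (forall t, A (g t)) ->
  continuous (u \o g).
Proof.
move=> /subspace_continuousP cu cg Ag t S /(cu _ (Ag t)) nS.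
have : nbhs t (g @^-1` [set y | A y -> S (u y)]) by exact: (cg t _ nS).
by apply: filterS => s /=; apply; exact: Ag.
Qed.

Lemma within_eq (T U : topologicalType) (A : set T) (f g : T -> U) :
  (forall x, A x -> f x = g x) -> {within A, continuous f} ->
  {within A, continuous g}.
Proof.
move=> fg; apply: subspace_eq_continuous => x.
by rewrite inE; exact: fg.
Qed.

Section Lifting.
Variable R : realType.
Notation P := (R * R)%type.

(** The bounded quantity is the cosine of the angle between the two values. It is 1 on the diagonal,
    hence above 1/2 nearby, and compactness makes the distance uniform. *)
Lemma compact_uniform_angle (V : normedModType R) (u : V -> P) (K : set V) :
  continuous u -> (forall x, on_circle (u x)) -> compact K ->
  exists2 e, 0 < e & forall x y, K x -> `|x - y| < e ->
    2^-1 <= (cmul (u x) (cconj (u y))).1.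
Proof.
move=> cu u1 /compact_near_coveringP cK.
pose Q (e : R) x := forall y, `|x - y| < e -> 2^-1 <= (cmul (u x) (cconj (u y))).1.
have : \forall e \near 0^'+, K `<=` Q e.
  apply: cK => x Kx.
  pose F (z : V * V) := (cmul (u z.1) (cconj (u z.2))).1.
  have cF : {for (x, x), continuous F}.
    apply: continuous_at_fst; apply: continuous_at_cmul.
      by apply: (continuous_comp cvg_fst); exact: cu.
    apply: continuous_at_cconj.
    by apply: (continuous_comp cvg_snd); exact: cu.
  have Fx : 2^-1 < F (x, x).
    move: (u1 x); rewrite /F /cmul /= mulrN opprK -!expr2 => ->.
    by lra.
  have [[U1 U2] [/= n1 n2] sub] : nbhs (x, x) [set z | 2^-1 < F z].
    exact: (cvgr_gt _ cF _ Fx).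
  have /nbhs_normP[d /= d0 dU] : nbhs x (U1 `&` U2) by exact: filterI.
  exists (ball x (d / 2), [set e | e < d / 2]) => /=.
    split; first by apply: nbhsx_ballx; rewrite divr_gt0.
    by apply: nbhs_right_lt; rewrite divr_gt0.
  move=> [x' e] /= [bx' ed] y xy; apply/ltW/(sub (x', y)).
  have hx : `|x - x'| < d / 2 by move: bx'; rewrite -ball_normE.
  split; [have []// : (U1 `&` U2) x' | have []// : (U1 `&` U2) y];
    apply: dU => /=.
    by move: (normr_ge0 (x - x')); lra.
  by have := ler_distD x' x y; lra.
move=> nQ; near (0 : R)^'+ => e; exists e => //.
by move=> x y Kx; apply: (near nQ e).
Unshelve. all: by end_near. Qed.

(* For [u x] the increments of argument along the segment from [0] to [x], cut
   into pieces short enough for the principal argument, are added up. *)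
Lemma circle_lift (V : normedModType R) (u : V -> P) (K : set V) :
  continuous u -> (forall x, on_circle (u x)) -> compact K ->
  (forall x t, K x -> 0 <= t <= 1 -> K (t *: x)) ->
  exists2 phi : V -> R, continuous phi & forall x, K x -> u x = cis (phi x).
Proof.
move=> cu u1 cK sK.
have [e e0 he] := compact_uniform_angle cu u1 cK.
have [M M0 hM] : exists2 M, 0 < M & forall x, K x -> `|x| <= M.
  have [M [_ hM]] := compact_bounded cK.
  exists (Num.max M 0 + 1) => [|x Kx].
    by rewrite ltr_wpDl // le_max lexx orbT.
  by apply: hM => //; rewrite ltr_pwDr // le_max lexx.
have Me0 : 0 <= M / e by rewrite divr_ge0 // ltW.
(* [N] exceeds [M / e], so each of [N] equal pieces of the segment is shorter than [e]. *)
have /= := archi_boundP Me0; set N := Num.bound _ => hN.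
have N0 : 0 < N%:R :> R by apply: le_lt_trans hN.
have [a ha] := circle_cis (u1 0).
pose F j x := cmul (u ((j.+1%:R / N%:R) *: x)) (cconj (u ((j%:R / N%:R) *: x))).
pose phi m x := a + \sum_(j < m) parg (F j x).
have phiP m x : (m <= N)%N -> K x -> u ((m%:R / N%:R) *: x) = cis (phi m x).
  elim: m => [|m IH] mN Kx; first by rewrite mul0r scale0r /phi big_ord0 addr0.
  rewrite /phi big_ord_recr /= addrA -/(phi m x) addrC -cmul_cis -IH ?(ltnW mN) //.
  rewrite cis_parg.
  - have [s hs] := circle_cis (u1 ((m%:R / N%:R) *: x)).
    have [t ht] := circle_cis (u1 ((m.+1%:R / N%:R) *: x)).
    by rewrite /F hs ht cconj_cis !cmul_cis addrNK.
  - exact: on_circle_cmul (u1 _) (on_circle_cconj (u1 _)).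
  apply: he.
    apply: sK => //; rewrite divr_ge0 //= ler_pdivrMr // mul1r ler_nat.
    exact: mN.
  rewrite -scalerBl -mulrBl -natr1 addrC addKr mul1r normrZ gtr0_norm ?invr_gt0 //.
  rewrite mulrC ltr_pdivrMr //; apply: le_lt_trans (hM _ Kx) _.
  by rewrite mulrC -ltr_pdivrMr.
exists (phi N) => [|x Kx]; last first.
  by rewrite -phiP // divff ?gt_eqF // scale1r.
(* The truncation in [parg] makes this continuity hold on all of [V], even where the angles are
   large. *)
move=> x; rewrite /phi; apply: cvgD; first exact: cvg_cst.
have scaleC c : {for x, continuous (fun y => u (c *: y))}.
  apply: (@continuous_comp _ _ _ (fun y : V => c *: y) u); last exact: cu.
  exact: scaler_continuous.
elim: (N) => [|m IH].
  by under eq_cvg do rewrite big_ord0; rewrite big_ord0; exact: cvg_cst.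
under eq_cvg do rewrite big_ord_recr; rewrite big_ord_recr; apply: cvgD => //=.
apply: continuous_at_parg; apply: continuous_at_cmul; first exact: scaleC.
by apply: continuous_at_cconj; exact: scaleC.
Qed.

Lemma I01E : @I01 R = `[0, 1]%classic.
Proof. by rewrite set_itvcc. Qed.

(** Two lifts differ by multiples of 2 pi. If the difference took two of them, the intermediate
    value theorem would give it an odd multiple of pi as well. *)
Lemma lift_unique (phi psi : R -> R) : continuous phi -> continuous psi ->
  (forall t, I01 t -> cis (phi t) = cis (psi t)) ->
  phi 1 - phi 0 = psi 1 - psi 0.
Proof.
move=> cphi cpsi h; pose D t := phi t - psi t.
have cD : continuous D by move=> t; apply: cvgB; [exact: cphi|exact: cpsi].
have hD t : I01 t -> exists k : int, D t = k%:~R * (2 * pi).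
  by move=> /h /cis_eq_2pi[k hk]; exists k; rewrite /D hk addrC addKr.
have pi0 := @pi_gt0 R.
have I0 : I01 (0 : R) by rewrite /I01 /=; lra.
have I1 : I01 (1 : R) by rewrite /I01 /=; lra.
have mid (k : int) t : I01 t -> D t <> k%:~R * (2 * pi) + pi.
  move=> /hD[l ->] e.
  have /eqP : (l%:~R * 2 - (k%:~R * 2 + 1)) * pi = 0 :> R by lra.
  rewrite mulf_eq0 (gt_eqF pi0) orbF subr_eq0.
  have -> : (k%:~R * 2 + 1 : R) = (k * 2 + 1)%:~R by rewrite intrD intrM.
  have -> : (l%:~R * 2 : R) = (l * 2)%:~R by rewrite intrM.
  by rewrite eqr_int => /eqP; lia.
suff : D 0 = D 1 by rewrite /D; lra.
have [[k hk] [l hl]] := (hD _ I0, hD _ I1).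
have [//|ne] := eqVneq (D 0) (D 1); exfalso.
have kl : k != l by apply: contraNneq ne => kl; rewrite hk hl kl.
(* The smaller multiple is taken, so that half a turn more lies between the two end values. *)
pose m := Num.min k l.
have [c cI] : exists2 c, c \in `[0, 1] & D c = m%:~R * (2 * pi) + pi.
  apply: IVT => //; first exact: continuous_subspaceT.
  rewrite hk hl ge_min le_max /m.
  move: kl; case: (ltgtP k l) => // kl _.
    have : (k%:~R + 1 <= l%:~R :> R) by rewrite -(intrD _ k 1) ler_int; lia.
    by move=> kl'; apply/andP; split; apply/orP; [left|right]; nra.
  have : (l%:~R + 1 <= k%:~R :> R) by rewrite -(intrD _ l 1) ler_int; lia.
  by move=> kl'; apply/andP; split; apply/orP; [right|left]; nra.
by apply: mid; move: cI; rewrite in_itv.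
Qed.

End Lifting.

(** * Simple closed curves *)

Section Curves.
Variable R : realType.
Notation P := (R * R)%type.
Notation I := (@I01 R).

(** A retraction onto [0, 1]: it turns a curve continuous on the interval into one continuous on the
    line, as [circle_lift] requires. *)
Definition clamp (t : R) : R := Num.max 0 (Num.min t 1).

Lemma clampI t : I (clamp t).
Proof.
rewrite /I01 /clamp /= le_max lexx /= ge_max ler01 /=.
by rewrite ge_min lexx orbT.
Qed.

Lemma clamp_id t : I t -> clamp t = t.
Proof. by move=> /andP[t0 t1]; rewrite /clamp min_l // max_r. Qed.

Lemma continuous_clamp : continuous clamp.
Proof.
move=> t; rewrite /clamp.
apply: (@continuous_max R R (cst 0) (fun t => Num.min t 1)); first exact: cvg_cst.
by apply: (@continuous_min R R id (cst 1)) => //; exact: cvg_cst.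
Qed.

Lemma I010 : I 0. Proof. by rewrite /I01 /= lexx ler01. Qed.
Lemma I011 : I 1. Proof. by rewrite /I01 /= lexx ler01. Qed.

Lemma I01_compact : compact I.
Proof. by rewrite I01E; exact: segment_compact. Qed.

(** [jordan_curve] with its parametrization exposed, since winding is measured along it. *)
Definition Jordan_param (g : R -> P) (C : set P) : Prop :=
  [/\ {within I, continuous g}, g 0 = g 1,
      forall s t, 0 <= s < 1 -> 0 <= t < 1 -> g s = g t -> s = t
    & C = g @` I].

Lemma curve_compact g C : Jordan_param g C -> compact C.
Proof. by case=> cg _ _ ->; apply: continuous_compact => //; exact: I01_compact. Qed.

Lemma curve_closed g C : Jordan_param g C -> closed C.
Proof.
by move=> /curve_compact; apply: compact_closed; exact: norm_hausdorff.
Qed.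

Lemma curve_lift g C (u : P -> P) : Jordan_param g C ->
  {within C, continuous u} -> (forall x, C x -> on_circle (u x)) ->
  exists phi : R -> R, continuous phi /\ forall t, I t -> u (g t) = cis (phi t).
Proof.
move=> [cg _ _ CE] cu u1.
have cgc : continuous (g \o clamp).
  by apply: within_comp cg continuous_clamp clampI.
have gC t : C ((g \o clamp) t) by rewrite CE; exists (clamp t) => //; exact: clampI.
have cug := within_comp cu cgc gC.
have starI (s t : R^o) : I s -> 0 <= t <= 1 -> I (t *: s).
  move=> /andP[s0 s1] /andP[t0 t1]; apply/andP; rewrite /GRing.scale /=.
  by split; nra.
have u1g t := u1 _ (gC t).
have [phi cphi hphi] := @circle_lift R R^o _ I cug u1g I01_compact starI.
by exists phi; split=> // t It; rewrite -hphi //= clamp_id.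
Qed.

(** A lift that returns to its initial value descends from the interval to the curve; compactness
    makes it continuous there, and the Tietze theorem extends it to the plane. *)
Lemma curve_log g C (u : P -> P) (phi : R -> R) : Jordan_param g C ->
  continuous phi -> (forall t, I t -> u (g t) = cis (phi t)) -> phi 0 = phi 1 ->
  exists2 Phi : P -> R, continuous Phi & forall x, C x -> u x = cis (Phi x).
Proof.
move=> Cg cphi uphi phi01; have cC := curve_closed Cg.
have [cg g01 ginj CE] := Cg.
have /choice[tau htau] : forall x, exists t, C x -> I t /\ g t = x.
  move=> x; have [|nC] := pselect (C x); last by exists 0.
  by rewrite CE => -[t It <-]; exists t.
pose Phi0 x := phi (tau x).
have Phi0E t : I t -> Phi0 (g t) = phi t.
  move=> It; have [] : I (tau (g t)) /\ g (tau (g t)) = g t.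
    by apply: htau; rewrite CE; exists t.
  rewrite /Phi0; move: (tau (g t)) => s Is gst.
  (* Replacing the parameter 1 by 0 moves both parameters into [0, 1), where [g] is injective. *)
  pose m (r : R) := if r == 1 then 0 else r.
  have mP r : I r -> [/\ 0 <= m r < 1, g (m r) = g r & phi (m r) = phi r].
    rewrite /m => /andP[r0 r1]; have [->|r1'] := eqVneq r 1.
      by rewrite lexx ltr01.
    by rewrite r0 lt_neqAle r1' r1.
  have [[s1 s2 <-] [t1 t2 <-]] := (mP _ Is, mP _ It).
  by rewrite (ginj _ _ s1 t1) // s2 t2.
(* The part of the curve that [Phi0] sends into a closed [W] is the image of a compact set of
   parameters, hence closed. *)
have Phi0C : {within C, continuous Phi0}.
  apply/continuous_closedP => W cW; apply/closed_subspaceP.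
  exists (g @` (I `&` phi @^-1` W)).
    apply: compact_closed; first exact: norm_hausdorff.
    apply: continuous_compact.
      by apply: continuous_subspaceW cg; exact: subIsetl.
    apply: compact_closedI; first exact: I01_compact.
    by move: cphi => /continuous_closedP; exact.
  rewrite eqEsubset; split=> x /= [].
    move=> [t [It]]; rewrite /preimage /= -(Phi0E _ It) => Wt gtx Cx.
    by split=> //; rewrite -gtx.
  move=> Wx Cx; split=> //; have [It <-] := htau _ Cx.
  by exists (tau x).
have [M M0 hM] : exists2 M, 0 < M & forall x, C x -> `|Phi0 x| <= M.
  have cI : compact (phi @` I).
    apply: continuous_compact; last exact: I01_compact.
    exact: continuous_subspaceT.
  have [M [_ hM]] := compact_bounded cI.
  exists (Num.max M 0 + 1) => [|x Cx].
    by rewrite ltr_wpDl // le_max lexx orbT.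
  apply: hM; first by rewrite ltr_pwDr // le_max lexx.
  by exists (tau x) => //; exact: (htau _ Cx).1.
have [Phi [PhiE cPhi _]] :=
  continuous_bounded_extension pseudometric_normal cC M0 Phi0C hM.
exists Phi => // x Cx; rewrite -PhiE ?inE //.
by have [It gx] := htau _ Cx; rewrite -{1}gx uphi.
Qed.

End Curves.

(** * Directions seen from a point *)

Section Directions.
Variable R : realType.
Notation P := (R * R)%type.
Implicit Types (p q x : P).

Lemma enorm_ge0 x : 0 <= enorm x. Proof. exact: sqrtr_ge0. Qed.

Lemma enorm_sqr x : enorm x ^+ 2 = x.1 ^+ 2 + x.2 ^+ 2.
Proof. by rewrite sqr_sqrtr // addr_ge0 // sqr_ge0. Qed.

Lemma enorm_eq0 x : enorm x = 0 -> x = (0, 0).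
Proof.
move=> x0; have := enorm_sqr x; rewrite x0 expr0n /= => /esym/eqP.
rewrite paddr_eq0 ?sqr_ge0 // !sqrf_eq0 => /andP[/eqP x1 /eqP x2].
by rewrite [x]surjective_pairing x1 x2.
Qed.

Lemma dist2_ge0 x p : 0 <= dist2 x p. Proof. exact: enorm_ge0. Qed.

Lemma dist2_sqr x p : dist2 x p ^+ 2 = (x.1 - p.1) ^+ 2 + (x.2 - p.2) ^+ 2.
Proof. exact: enorm_sqr. Qed.

Lemma dist2_eq0 x p : dist2 x p = 0 -> x = p.
Proof.
move=> /enorm_eq0[/eqP + /eqP]; rewrite !subr_eq0 => /eqP h1 /eqP h2.
by rewrite [x]surjective_pairing h1 h2 -surjective_pairing.
Qed.

Lemma dist2xx x : dist2 x x = 0.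
Proof. by rewrite /dist2 /enorm !subrr expr0n addr0 sqrtr0. Qed.

Lemma dist2_gt0 x p : x <> p -> 0 < dist2 x p.
Proof.
move=> xp; rewrite lt_neqAle dist2_ge0 andbT eq_sym.
by apply/eqP => /dist2_eq0.
Qed.

Lemma continuous_dist2 p : continuous (fun x => dist2 x p).
Proof.
move=> x; apply: continuous_at_enorm; apply: continuous_at_pair.
  by apply: cvgB; [exact: cvg_fst|exact: cvg_cst].
by apply: cvgB; [exact: cvg_snd|exact: cvg_cst].
Qed.

(** Division by 0 makes this the zero vector at [x = p]. *)
Definition dir p x : P := ((x.1 - p.1) / dist2 x p, (x.2 - p.2) / dist2 x p).

Lemma dir_on_circle p x : x <> p -> on_circle (dir p x).
Proof.
move=> /dist2_gt0 d0; rewrite /on_circle /dir /= !expr_div_n -mulrDl -dist2_sqr.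
by rewrite divff // expf_neq0 // gt_eqF.
Qed.

Lemma continuous_dir p x : x <> p -> {for x, continuous (dir p)}.
Proof.
move=> /dist2_gt0 d0.
have cd : {for x, continuous (fun y => (dist2 y p)^-1)}.
  by apply: cvgV; [rewrite gt_eqF|exact: continuous_dist2].
apply: continuous_at_pair; apply: cvgM => //.
  by apply: cvgB; [exact: cvg_fst|exact: cvg_cst].
by apply: cvgB; [exact: cvg_snd|exact: cvg_cst].
Qed.

Lemma within_dir p (A : set P) : ~ A p -> {within A, continuous (dir p)}.
Proof.
move=> Ap; apply: continuous_in_subspaceT => x; rewrite inE => Ax.
by apply: continuous_dir => xp; apply: Ap; rewrite -xp.
Qed.

Definition circle_pt p (r t : R) : P := (p.1 + r * cos t, p.2 + r * sin t).

Lemma dist2_circle_pt p r t : 0 <= r -> dist2 (circle_pt p r t) p = r.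
Proof.
move=> r0; rewrite /dist2 /enorm /circle_pt /= !(addrAC _ _ (- _)) !subrr !add0r.
by rewrite !exprMn -mulrDr cos2Dsin2 mulr1 sqrtr_sqr ger0_norm.
Qed.

Lemma dir_circle_pt p r t : 0 < r -> dir p (circle_pt p r t) = cis t.
Proof.
move=> r0; rewrite /dir dist2_circle_pt ?ltW // /circle_pt /=.
by rewrite !(addrAC _ _ (- _)) !subrr !add0r ![r * _]mulrC !mulfK ?gt_eqF.
Qed.

Lemma continuous_circle_pt p r (h : R -> R) : continuous h ->
  continuous (fun t => circle_pt p r (h t)).
Proof.
move=> ch t; have cc := continuous_at_cis (ch t).
apply: (@continuous_at_pair _ _ (fun t => p.1 + r * cos (h t))
    (fun t => p.2 + r * sin (h t))); (apply: cvgD; first exact: cvg_cst);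
  (apply: cvgM; first exact: cvg_cst).
  exact: (continuous_at_fst cc).
exact: (continuous_at_snd cc).
Qed.

Definition turn (t : R) : R := 2 * pi * t.

Lemma continuous_turn : continuous turn.
Proof. by move=> t; apply: cvgM; [exact: cvg_cst|]. Qed.

Lemma cis_turn1 : cis (turn 1) = cis (turn 0) :> P.
Proof. by rewrite /turn mulr0 mulr1 -(cisD2pi 0 1) add0r mul1r. Qed.

Lemma circle_pt_turn1 p r : circle_pt p r (turn 1) = circle_pt p r (turn 0).
Proof. by rewrite /circle_pt; case: cis_turn1 => -> ->. Qed.

(* On a large circle the directions from [p] and from the origin differ by less
   than a right angle, so they turn equally often. *)
Lemma dir_far_lift p (r : R) : 0 < r -> 4 * enorm p <= r ->
  exists l : R -> R, [/\ continuous l, l 0 = l 1 &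
    forall t, dir p (circle_pt (0, 0) r (turn t)) = cis (turn t + l t)].
Proof.
move=> r0 pr; pose c t := circle_pt (0, 0) r (turn t).
have np := enorm_ge0 p; have np2 := enorm_sqr p.
have cp t : c t <> p.
  move=> ctp; have := dist2_circle_pt (0, 0) (turn t) (ltW r0).
  by rewrite -/(c t) ctp /dist2 !subr0 -surjective_pairing; lra.
(* [w t] is the rotation from the direction seen from the origin to the one seen from [p]. *)
pose w t := cmul (dir p (c t)) (cconj (cis (turn t))).
have w1 t : on_circle (w t).
  apply: on_circle_cmul; first exact/dir_on_circle/cp.
  exact/on_circle_cconj/cis_on_circle.
have w2 t : 2^-1 <= (w t).1.
  have := dist2_gt0 (cp t); have := dist2_sqr (c t) p.
  rewrite /w /cmul /dir /= !add0r mulrN opprK.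
  move: (dist2 (c t) p) => d; have := cos2Dsin2 (turn t).
  move: (cos _) (sin _) => a b ab d2 d0.
  rewrite mulrAC (mulrAC (_ - p.2)) -mulrDl ler_pdivlMr //.
  (* The cosine in question is [(r - s) / d], and [s] is the component of [p] along the ray, hence
     at most [enorm p <= r / 4] in absolute value. *)
  set s := p.1 * a + p.2 * b.
  have -> : (r * a - p.1) * a + (r * b - p.2) * b = r - s.
    by rewrite -[in RHS](mulr1 r) -ab /s; ring.
  have s2 : s ^+ 2 <= enorm p ^+ 2.
    rewrite np2 -subr_ge0.
    have -> : p.1 ^+ 2 + p.2 ^+ 2 - s ^+ 2 = (p.1 * b - p.2 * a) ^+ 2.
      by rewrite -[X in X - _]mulr1 -ab /s; ring.
    exact: sqr_ge0.
  have sp : s <= enorm p.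
    apply: le_trans (ler_norm _) _.
    by rewrite -(ler_pXn2r (ltn0Sn 1)) ?nnegrE // real_normK ?num_real.
  have sp' : - enorm p <= s.
    rewrite lerNl; apply: le_trans (ler_norm _) _.
    by rewrite normrN -(ler_pXn2r (ltn0Sn 1)) ?nnegrE // real_normK ?num_real.
  have d2' : d ^+ 2 = r ^+ 2 - 2 * r * s + enorm p ^+ 2.
    have -> : r ^+ 2 = r ^+ 2 * (a ^+ 2 + b ^+ 2) by rewrite ab mulr1.
    by rewrite d2 np2 /s; ring.
  have : d <= 2 * (r - s); last by lra.
  rewrite -(ler_pXn2r (ltn0Sn 1)) ?nnegrE ?(ltW d0) //; last by lra.
  rewrite d2'; move: pr np sp sp'; move: (enorm p) => e; clear; nra.
exists (fun t => parg (w t)); split.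
- move=> t; apply: continuous_at_parg; apply: continuous_at_cmul.
    apply: (@continuous_comp _ _ _ c (dir p)); last exact/continuous_dir/cp.
    exact/continuous_circle_pt/continuous_turn.
  by apply: continuous_at_cconj; apply: continuous_at_cis; exact: continuous_turn.
- by rewrite /w /c circle_pt_turn1 cis_turn1.
- move=> t; rewrite -cmul_cis cis_parg // /w -/(c t).
  have [s ->] := circle_cis (dir_on_circle (@cp t)).
  by rewrite cconj_cis !cmul_cis; congr cis; ring.
Qed.

Lemma square_compact (r : R) : compact [set x : P | `|x.1| <= r /\ `|x.2| <= r].
Proof.
have -> : [set x : P | `|x.1| <= r /\ `|x.2| <= r] =
    (`[- r, r]%classic `*` `[- r, r]%classic).
  by rewrite eqEsubset; split=> x /=; rewrite !in_itv /= !ler_norml => -[? ?].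
by apply: compact_setX; exact: segment_compact.
Qed.

(* If the boundary winds [a] times around [p] and [b] times around [q], then
   [dir p ^ b * dir q ^ -a] is [cis Phi] on it. Replacing it by [cis Phi] on [X]
   gives a map from the whole plane to the circle, whose degree [b - a] on a
   large circle vanishes since the plane is contractible. *)
Lemma interior_dir_log (X : set P) (g : R -> P) p q : closed X ->
  bounded_plane X -> Jordan_param g (boundary X) -> X° p -> X° q ->
  exists2 Phi : P -> R, continuous Phi &
    forall x, boundary X x -> dir q x = cmul (cis (Phi x)) (dir p x).
Proof.
move=> clX [M hM] gC pX qX; set C := boundary X in gC *.
have CE : C = X `\` X° by rewrite /C /boundary -(closure_id _).1.
have [nCp nCq] : ~ C p /\ ~ C q by rewrite CE; split=> -[].
have CdirP z x : X° z -> C x -> x <> z by rewrite CE => zX [_ nx] xz; rewrite xz in nx.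
have [al [cal hal]] := curve_lift gC (within_dir nCp)
  (fun x Cx => dir_on_circle (CdirP p x pX Cx)).
have [be [cbe hbe]] := curve_lift gC (within_dir nCq)
  (fun x Cx => dir_on_circle (CdirP q x qX Cx)).
have g01 : g 1 = g 0 by case: gC.
have [a ha] : exists a : int, al 1 = al 0 + a%:~R * (2 * pi).
  by apply: cis_eq_2pi; rewrite -!hal ?g01 //; [exact: I010|exact: I011].
have [b hb] : exists b : int, be 1 = be 0 + b%:~R * (2 * pi).
  by apply: cis_eq_2pi; rewrite -!hbe ?g01 //; [exact: I010|exact: I011].
have ab : a = b.
  pose u x := cmul (cpow (dir p x) b) (cpow (dir q x) (- a)).
  pose phi t := b%:~R * al t + (- a)%:~R * be t.
  have cphi : continuous phi.
    move=> t; apply: cvgD; (apply: cvgM; first exact: cvg_cst).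
      exact: cal.
    exact: cbe.
  have uphi t : I01 t -> u (g t) = cis (phi t).
    by move=> It; rewrite /u hal // hbe // !cpow_cis cmul_cis.
  have phi01 : phi 0 = phi 1 by rewrite /phi ha hb mulrNz; ring.
  have [Phi cPhi hPhi] := curve_log gC cphi uphi phi01.
  have cu x : x <> p -> x <> q -> {for x, continuous u}.
    by move=> xp xq; apply: continuous_at_cmul; apply: continuous_at_cpow;
      exact: continuous_dir.
  have u1 x : x <> p -> x <> q -> on_circle (u x).
    by move=> xp xq; apply: on_circle_cmul; apply: on_circle_cpow;
      exact: dir_on_circle.
  (* Both [X] and the complement of its interior are closed, and the two formulas agree on their
     intersection, the boundary, so they glue continuously. *)
  pose F x := if x \in X then cis (Phi x) else u x.
  have Xpq x : ~ X° x -> x <> p /\ x <> q.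
    by move=> nx; split=> xz; rewrite xz in nx.
  have FC x : ~ X° x -> F x = u x.
    rewrite /F; case: ifPn => //; rewrite inE => Xx nXx.
    by rewrite hPhi // CE.
  have cF : continuous F.
    rewrite continuous_subspace_setT -(setUv X°).
    have -> : X° `|` ~` X° = X `|` ~` X°.
      rewrite setUv eqEsubset; split=> x // _.
      by have [/interior_subset|] := pselect (X° x); [left|right].
    apply: withinU_continuous => //.
    - exact/open_closedC/open_interior.
    - have FPhi x : X x -> cis (Phi x) = F x by move=> /mem_set xX; rewrite /F xX.
      apply: (within_eq FPhi); apply: continuous_subspaceT => x.
      exact/continuous_at_cis/cPhi.
    - apply: (within_eq (fun x nx => esym (FC x nx))).
      apply: continuous_in_subspaceT => x; rewrite inE /= => /Xpq[? ?].
      exact: cu.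
  have F1 x : on_circle (F x).
    have [Xx|nXx] := pselect (X° x).
      by rewrite /F mem_set; [exact: cis_on_circle|exact: interior_subset].
    by rewrite FC //; case: (Xpq _ nXx) => ? ?; exact: u1.
  (* This radius puts the circle outside [X] and meets the condition of [dir_far_lift] for both
     points. *)
  pose r := `|M| + 4 * (enorm p + enorm q) + 1.
  have [np nq] := (enorm_ge0 p, enorm_ge0 q).
  have M0 := normr_ge0 M; have MM := ler_norm M.
  have r0 : 0 < r by rewrite /r; lra.
  have star (x : P) t : `|x.1| <= r /\ `|x.2| <= r -> 0 <= t <= 1 ->
      `|(t *: x).1| <= r /\ `|(t *: x).2| <= r.
    move=> [h1 h2] /andP[t0 t1]; rewrite /= !normrM (ger0_norm t0).
    by split; [have := normr_ge0 x.1|have := normr_ge0 x.2]; nra.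
  have [psi cpsi hpsi] := circle_lift cF F1 (@square_compact r) star.
  have [lp [clp lp01 hlp]] : exists l : R -> R, [/\ continuous l, l 0 = l 1 &
    forall t, dir p (circle_pt (0, 0) r (turn t)) = cis (turn t + l t)].
    by apply: dir_far_lift => //; rewrite /r; lra.
  have [lq [clq lq01 hlq]] : exists l : R -> R, [/\ continuous l, l 0 = l 1 &
    forall t, dir q (circle_pt (0, 0) r (turn t)) = cis (turn t + l t)].
    by apply: dir_far_lift => //; rewrite /r; lra.
  (* Two lifts of [F] along the large circle: [h1] grows by [b - a] turns, whereas [h2] comes from a
     lift on a square containing the circle and returns to its start. *)
  pose h1 t := b%:~R * (turn t + lp t) + (- a)%:~R * (turn t + lq t).
  pose h2 t := psi (circle_pt (0, 0) r (turn t)).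
  have ch1 : continuous h1.
    move=> t; apply: cvgD; (apply: cvgM; first exact: cvg_cst); apply: cvgD;
      [exact: continuous_turn|exact: clp|exact: continuous_turn|exact: clq].
  have ch2 : continuous h2.
    move=> t; apply: (@continuous_comp _ _ _ (fun t => circle_pt (0, 0) r (turn t)) psi);
      last exact: cpsi.
    exact/continuous_circle_pt/continuous_turn.
  have h12 t : I01 t -> cis (h1 t) = cis (h2 t).
    move=> _; rewrite -hpsi; last first.
      rewrite /= !add0r !normrM (gtr0_norm r0).
      by split; rewrite ger_pMr // ?cos_max ?sin_max.
    rewrite FC /u; first by rewrite hlp hlq !cpow_cis cmul_cis.
    move=> /interior_subset/hM.
    have := dist2_circle_pt (0, 0) (turn t) (ltW r0).
    by rewrite /dist2 !subr0 -surjective_pairing => ->; rewrite /r; lra.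
  have := lift_unique ch1 ch2 h12.
  rewrite /h1 /h2 circle_pt_turn1 lp01 lq01 /turn mulrNz => e.
  have /eqP : (b%:~R - a%:~R) * pi = 0 :> R by lra.
  rewrite mulf_eq0 (gt_eqF (pi_gt0 R)) orbF subr_eq0 eqr_int.
  by move=> /eqP.
(* With equal winding numbers the angle between the two direction fields closes up along the
   boundary. *)
pose phi t := be t - al t.
have cphi : continuous phi by move=> t; apply: cvgB; [exact: cbe|exact: cal].
have uphi t : I01 t -> cmul (dir q (g t)) (cconj (dir p (g t))) = cis (phi t).
  by move=> It; rewrite hal // hbe // cconj_cis cmul_cis.
have phi01 : phi 0 = phi 1 by rewrite /phi ha hb ab; ring.
have [Phi cPhi hPhi] :=
  curve_log (u := fun x => cmul (dir q x) (cconj (dir p x))) gC cphi uphi phi01.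
exists Phi => // x Cx; rewrite -hPhi //.
have [s ->] := circle_cis (dir_on_circle (CdirP p x pX Cx)).
have [t ->] := circle_cis (dir_on_circle (CdirP q x qX Cx)).
by rewrite cconj_cis !cmul_cis; congr cis; ring.
Qed.

End Directions.

(** * Filling discs *)

Section Discs.
Variable R : realType.
Notation P := (R * R)%type.
Implicit Types (p q x : P).

Lemma dist2_sym x y : dist2 x y = dist2 y x :> R.
Proof. by rewrite /dist2 /enorm /= -(sqrrN (x.1 - _)) -(sqrrN (x.2 - _)) !opprB. Qed.

Lemma enorm_triangle (u v : P) : enorm (u.1 + v.1, u.2 + v.2) <= enorm u + enorm v.
Proof.
have [nu nv] := (enorm_ge0 u, enorm_ge0 v).
have [su sv] := (enorm_sqr u, enorm_sqr v).
rewrite -(ler_pXn2r (ltn0Sn 1)) ?nnegrE ?enorm_ge0 ?addr_ge0 // enorm_sqr /=.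
have : u.1 * v.1 + u.2 * v.2 <= enorm u * enorm v.
  apply: le_trans (ler_norm _) _.
  rewrite -(ler_pXn2r (ltn0Sn 1)) ?nnegrE ?mulr_ge0 // real_normK ?num_real //.
  rewrite exprMn su sv -subr_ge0.
  have -> : (u.1 ^+ 2 + u.2 ^+ 2) * (v.1 ^+ 2 + v.2 ^+ 2) -
    (u.1 * v.1 + u.2 * v.2) ^+ 2 = (u.1 * v.2 - u.2 * v.1) ^+ 2 by ring.
  exact: sqr_ge0.
by rewrite !sqrrD su sv; lra.
Qed.

Lemma dist2_triangle (x y z : P) : dist2 x z <= dist2 x y + dist2 y z.
Proof.
apply: le_trans (enorm_triangle _ _) => /=.
by rewrite /dist2 !addrA !addrNK.
Qed.

(** The product type carries the maximum norm; this compares its balls with Euclidean discs. *)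
Lemma norm_le_dist2 x p : `|x - p| <= dist2 x p.
Proof.
rewrite /dist2 /enorm prod_normE /= ge_max -!sqrtr_sqr.
by apply/andP; split; apply: ler_wsqrtr; rewrite ?lerDl ?lerDr sqr_ge0.
Qed.

Lemma circle_Jordan p (r : R) : 0 < r ->
  Jordan_param (fun t => circle_pt p r (turn t)) [set x | dist2 x p = r].
Proof.
move=> r0; have pi0 := pi_gt0 R; split.
- exact/continuous_subspaceT/continuous_circle_pt/continuous_turn.
- by rewrite circle_pt_turn1.
- move=> s t /andP[s0 s1] /andP[t0 t1] /(congr1 (dir p)).
  rewrite !dir_circle_pt // => /cis_eq_2pi[k hk].
  have stk : s = t + k%:~R.
    apply: (mulfI (lt0r_neq0 (mulr_gt0 (@ltr0Sn R 1) pi0))).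
    by move: hk; rewrite /turn; lra.
  have k1 : (k < 1)%R by rewrite -(ltr_int R); lra.
  have k2 : (-1 < k)%R by rewrite -(ltr_int R) mulrNz; lra.
  by have k0 : k = 0 by [lia]; rewrite stk k0 addr0.
- rewrite eqEsubset; split=> x /=; last first.
    by move=> [t _ <-]; rewrite dist2_circle_pt // ltW.
  move=> xr; have xp : x <> p by move=> xp; move: xr; rewrite xp dist2xx; lra.
  have [th hth] := circle_cis (dir_on_circle xp).
  pose t := th / (2 * pi); pose k := Num.floor t.
  have tk : I01 (t - k%:~R).
    have := floor_le t; have := floorD1_gt t; rewrite intrD -/k => h1 h2.
    by apply/andP; split; lra.
  exists (t - k%:~R) => //.
  have turnE : turn (t - k%:~R) = th + (- k)%:~R * (2 * pi).
    rewrite /turn mulrBr /t mulrCA divff ?mulr1 ?mulrNz; first by ring.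
    by rewrite gt_eqF // mulr_gt0.
  rewrite /circle_pt turnE; have := cisD2pi th (- k); rewrite -hth /cis => -[-> ->].
  rewrite /dir /= xr [RHS]surjective_pairing.
  by congr (_, _); field; rewrite gt_eqF.
Qed.

(** [k] is the winding number of [U] along the circle; division by the [k]-th power of [dir q]
    leaves a field whose lift closes up. *)
Lemma circle_log (U : P -> P) q (r : R) : 0 < r ->
  {within [set x | dist2 x q = r], continuous U} ->
  (forall x, dist2 x q = r -> on_circle (U x)) ->
  exists k : int, exists2 Phi : P -> R, continuous Phi &
    forall x, dist2 x q = r -> U x = cmul (cpow (dir q x) k) (cis (Phi x)).
Proof.
move=> r0 cU U1; have gC := circle_Jordan q r0.
have [phi [cphi hphi]] := curve_lift gC cU U1.
have [k hk] : exists k : int, phi 1 = phi 0 + k%:~R * (2 * pi).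
  apply: cis_eq_2pi; rewrite -!hphi ?circle_pt_turn1 //; [exact: I010|exact: I011].
exists k; pose psi t := phi t + (- k)%:~R * turn t.
have cpsi : continuous psi.
  move=> t; apply: cvgD; first exact: cphi.
  by apply: cvgM; [exact: cvg_cst|exact: continuous_turn].
have upsi t : I01 t -> cmul (U (circle_pt q r (turn t)))
    (cpow (dir q (circle_pt q r (turn t))) (- k)) = cis (psi t).
  by move=> It; rewrite hphi // dir_circle_pt // cpow_cis cmul_cis.
have psi01 : psi 0 = psi 1 by rewrite /psi hk /turn mulrNz; ring.
have [Phi cPhi hPhi] :=
  curve_log (u := fun x => cmul (U x) (cpow (dir q x) (- k))) gC cpsi upsi psi01.
exists Phi => // x xq; rewrite -hPhi //.
have xq' : x <> q by move=> xq'; move: xq; rewrite xq' dist2xx; lra.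
have [s ->] := circle_cis (dir_on_circle xq').
have [t ->] := circle_cis (U1 _ xq).
by rewrite !cpow_cis !cmul_cis; congr cis; rewrite mulrNz; ring.
Qed.

Lemma closed_disc q (r : R) : closed [set x | dist2 x q <= r].
Proof.
have := @closed_le R r; move/continuous_closedP: (@continuous_dist2 R q); exact.
Qed.

(* A field of directions on a region with a hole around [q] extends over the
   hole after division by the appropriate power of [dir q]; on the boundary of
   [X] that power is compensated by a power of [dir p]. *)
Lemma fill_hole (X A : set P) (g : R -> P) (U : P -> P) p q (r : R) :
  closed X -> bounded_plane X -> Jordan_param g (boundary X) ->
  X° p -> X° q -> 0 < r -> closed A -> boundary X `<=` A ->
  [set x | dist2 x q = r] `<=` A -> (forall x, A x -> r <= dist2 x q) ->
  ~ A p -> r < dist2 p q ->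
  {within A, continuous U} -> (forall x, A x -> on_circle (U x)) ->
  exists U' : P -> P,
    [/\ {within A `|` [set x | dist2 x q <= r], continuous U'},
        forall x, (A `|` [set x | dist2 x q <= r]) x -> on_circle (U' x)
      & forall x, boundary X x -> U' x = U x].
Proof.
move=> clX bX gC pX qX r0 clA bA SA Aq nAp pq cU U1.
have [k [Phi cPhi hPhi]] : exists k : int, exists2 Phi : P -> R, continuous Phi &
    forall x, dist2 x q = r -> U x = cmul (cpow (dir q x) k) (cis (Phi x)).
  by apply: circle_log => // [|x xq]; [exact: continuous_subspaceW cU|apply/U1/SA].
have [Psi cPsi hPsi] := interior_dir_log clX bX gC pX qX.
set D := [set x | dist2 x q <= r].
have nAq : ~ A q by move=> /Aq; rewrite dist2xx; lra.
have Ane x z : A x -> ~ A z -> x <> z by move=> Ax nz xz; rewrite -xz in nz.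
pose G x := if x \in A then cmul (U x) (cpow (dir q x) (- k)) else cis (Phi x).
have GA x : A x -> cmul (U x) (cpow (dir q x) (- k)) = G x.
  by move=> /mem_set xA; rewrite /G xA.
(* [A] and the disc meet only in the circle, where [Phi] was chosen to make both formulas agree. *)
have GD x : D x -> cis (Phi x) = G x.
  rewrite /G; case: ifPn => //; rewrite inE => Ax Dx.
  have xq : dist2 x q = r by apply/eqP; rewrite eq_le Dx Aq.
  have [s hs] := circle_cis (dir_on_circle (Ane x q Ax nAq)).
  rewrite hPhi // hs !cpow_cis !cmul_cis; congr cis; rewrite mulrNz; ring.
have cG : {within A `|` D, continuous G}.
  apply: withinU_continuous => //; first exact: closed_disc.
    apply: (within_eq GA) => x; apply: continuous_at_cmul; first exact: cU.
    by apply: continuous_at_cpow; exact: within_dir.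
  apply: (within_eq GD); apply: continuous_subspaceT => x.
  exact/continuous_at_cis/cPhi.
have G1 x : (A `|` D) x -> on_circle (G x).
  move=> [Ax|Dx]; last by rewrite -GD //; exact: cis_on_circle.
  rewrite -GA //; apply: on_circle_cmul; first exact: U1.
  exact/on_circle_cpow/dir_on_circle/(Ane _ _ Ax).
have nADp : ~ (A `|` D) p by move=> [//|]; rewrite /D /=; lra.
have ckPsi : continuous (fun x => cis (k%:~R * Psi x)).
  move=> x; apply: (@continuous_at_cis _ _ (fun x => k%:~R * Psi x)).
  by apply: cvgM; [exact: cvg_cst|exact: cPsi].
(* The second factor equals the [k]-th power of [dir q] on the boundary by the choice of [Psi], so
   [U] is restored there; it can be singular only at [p], outside the region. *)
exists (fun x => cmul (G x) (cmul (cis (k%:~R * Psi x)) (cpow (dir p x) k))); split.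
- move=> x; apply: continuous_at_cmul; first exact: cG.
  apply: continuous_at_cmul; last by apply: continuous_at_cpow; exact: within_dir.
  by move: x; exact: continuous_subspaceT.
- move=> x ADx; apply: on_circle_cmul; first exact: G1.
  apply: on_circle_cmul; first exact: cis_on_circle.
  apply/on_circle_cpow/dir_on_circle => xp; apply: nADp; rewrite -xp.
  exact: ADx.
- move=> x bx; have Ax := bA _ bx; rewrite -GA // hPsi //.
  have [s ->] := circle_cis (dir_on_circle (Ane _ _ Ax nAp)).
  have [t ->] := circle_cis (U1 _ Ax).
  rewrite cmul_cis !cpow_cis !cmul_cis; congr cis; rewrite mulrNz; ring.
Qed.

(** The rims of the discs are kept, so the set is closed for closed [X] and fields can be glued
    along them. *)
Definition off_discs (X : set P) (r : R) (s : seq P) : set P :=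
  [set x | X x /\ forall z, z \in s -> r <= dist2 x z].

Lemma closed_off_discs (X : set P) r s : closed X -> closed (off_discs X r s).
Proof.
move=> clX; elim: s => [|z s IH].
  have -> // : off_discs X r [::] = X.
  by rewrite eqEsubset; split=> x; [case|split].
have -> : off_discs X r (z :: s) =
    off_discs X r s `&` [set x | r <= dist2 x z].
  rewrite eqEsubset; split=> x.
    move=> [Xx h]; split; last by apply: h; rewrite mem_head.
    by split=> // y ys; apply: h; rewrite in_cons ys orbT.
  move=> [[Xx h] xz]; split=> // y; rewrite in_cons => /orP[/eqP -> //|].
  exact: h.
apply: closedI => //.
have := @closed_ge R r; move/continuous_closedP: (@continuous_dist2 R z); exact.
Qed.

(** The discs around the points of [s] are filled one at a time, each passing its winding on to [p],
    whose disc stays unfilled. *)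
Lemma fill_holes (X : set P) (g : R -> P) p (r : R) (s : seq P) (U : P -> P) :
  closed X -> bounded_plane X -> Jordan_param g (boundary X) -> 0 < r ->
  (forall z x, z \in p :: s -> dist2 x z <= r -> X° x) ->
  (forall y z, y \in p :: s -> z \in p :: s -> y != z -> 2 * r < dist2 y z) ->
  uniq (p :: s) ->
  {within off_discs X r (p :: s), continuous U} ->
  (forall x, off_discs X r (p :: s) x -> on_circle (U x)) ->
  exists U' : P -> P,
    [/\ {within off_discs X r [:: p], continuous U'},
        forall x, off_discs X r [:: p] x -> on_circle (U' x)
      & forall x, boundary X x -> U' x = U x].
Proof.
move=> clX bX gC r0; elim: s U => [|q s IH] U DX sep us cU U1; first by exists U.
have sub z : z \in p :: s -> z \in [:: p, q & s].
  by rewrite !in_cons => /orP[->|->]; rewrite ?orbT.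
have pin : p \in [:: p, q & s] by rewrite mem_head.
have qin : q \in [:: p, q & s] by rewrite !in_cons eqxx orbT.
have [pq /andP[qs us']] : p != q /\ (q \notin s) && uniq (p :: s).
  move: us; rewrite /= in_cons negb_or -!andbA => /and4P[? ? ? ?].
  by split=> //; apply/and3P; split.
have intD z : z \in [:: p, q & s] -> X° z.
  by move=> zs; apply: (DX z) => //; rewrite dist2xx ltW.
have BX x z : boundary X x -> z \in [:: p, q & s] -> r <= dist2 x z.
  move=> [_ nX] zs; rewrite leNgt; apply/negP => xz; apply: nX.
  by apply: (DX z) => //; exact: ltW.
have bA : boundary X `<=` off_discs X r [:: p, q & s].
  move=> x bx; split; last by move=> z; exact: BX.
  by case: bx => + _; rewrite -(closure_id _).1.
(* The circle around [q] avoids the other discs because the centres are more than [2 * r] apart. *)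
have SA : [set x | dist2 x q = r] `<=` off_discs X r [:: p, q & s].
  move=> x /= xq; split.
    by apply: interior_subset; apply: (DX q) => //; rewrite xq.
  move=> z zs; have [->|zq] := eqVneq z q; first by rewrite xq.
  have := sep _ _ zs qin zq; have := dist2_triangle z x q.
  by rewrite xq (dist2_sym z x); lra.
have nAp : ~ off_discs X r [:: p, q & s] p.
  by move=> [_ /(_ _ pin)]; rewrite dist2xx; lra.
have rpq : r < dist2 p q by have := sep _ _ pin qin pq; lra.
have [U' [cU' U'1 U'b]] := fill_hole clX bX gC (intD _ pin) (intD _ qin) r0
  (@closed_off_discs X r [:: p, q & s] clX) bA SA (fun x h => h.2 _ qin) nAp rpq cU U1.
have subA : off_discs X r (p :: s) `<=`
    off_discs X r [:: p, q & s] `|` [set x | dist2 x q <= r].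
  move=> x [Xx h]; have [xq|xq] := leP (dist2 x q) r; first by right.
  left; split=> // z; rewrite !in_cons => /or3P[/eqP -> | /eqP -> | zs].
  - by apply: h; rewrite mem_head.
  - exact: ltW.
  - by apply: h; rewrite in_cons zs orbT.
have [] := IH U' _ _ us'.
- by move=> z x /sub; exact: DX.
- by move=> y z /sub ys /sub; exact: sep.
- exact: continuous_subspaceW cU'.
- by move=> x /subA; exact: U'1.
move=> U'' [c1 c2 c3]; exists U''; split=> // x bx.
by rewrite c3 // U'b.
Qed.

End Discs.

(** * Fields with a single zero *)

Lemma near_all_seq (I : Type) (F : set_system I) (T : eqType) (s : seq T)
    (Q : T -> I -> Prop) : Filter F ->
  (forall z, z \in s -> \forall i \near F, Q z i) ->
  \forall i \near F, forall z, z \in s -> Q z i.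
Proof.
move=> FF; elim: s => [|y s IH] h; first by apply: nearW.
have h1 := h y (mem_head y s).
have h2 : \forall i \near F, forall z, z \in s -> Q z i.
  by apply: IH => z zs; apply: h; rewrite in_cons zs orbT.
near=> i => z; rewrite in_cons => /orP[/eqP ->|]; first by near: i.
by move: z; near: i.
Unshelve. all: by end_near. Qed.

Section SingleZero.
Variable R : realType.
Notation P := (R * R)%type.

(** Every requirement holds for all sufficiently small radii, and there are finitely many of
    them. *)
Lemma disjoint_discs (O : set P) (s : seq P) : open O -> (forall z, z \in s -> O z) ->
  exists2 r : R, 0 < r &
    (forall z x, z \in s -> dist2 x z <= r -> O x) /\
    (forall y z, y \in s -> z \in s -> y != z -> 2 * r < dist2 y z).
Proof.
move=> oO sO.
have near1 : \forall r \near (0 : R)^'+, forall z, z \in s ->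
    forall x, dist2 x z <= r -> O x.
  apply: near_all_seq => z /sO Oz.
  have /nbhs_normP[e /= e0 eO] : nbhs z O by exact: open_nbhs_nbhs.
  near=> r => x xr; apply: eO => /=; rewrite distrC.
  apply: le_lt_trans (norm_le_dist2 _ _) _; apply: le_lt_trans xr _.
  by near: r; exact: nbhs_right_lt.
have near2 : \forall r \near (0 : R)^'+, forall y, y \in s -> forall z, z \in s ->
    y != z -> 2 * r < dist2 y z.
  apply: near_all_seq => y _; apply: near_all_seq => z _.
  have [->|yz] := eqVneq y z; first by apply: nearW.
  have d0 : 0 < dist2 y z / 2 by rewrite divr_gt0 // dist2_gt0 //; exact/eqP.
  by near=> r => _; rewrite mulrC -ltr_pdivlMr.
near (0 : R)^'+ => r; exists r => //; split.
  by move=> z x zs; exact: (near near1 r).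
by move=> y z ys zs; exact: (near near2 r).
Unshelve. all: by end_near. Qed.

Definition cscale (c : R) (u : P) : P := (c * u.1, c * u.2).

Lemma enorm_cscale c u : 0 <= c -> on_circle u -> enorm (cscale c u) = c.
Proof.
move=> c0 u1; rewrite /enorm /cscale /= !exprMn -mulrDr u1 mulr1.
by rewrite sqrtr_sqr ger0_norm.
Qed.

Lemma continuous_at_cscale (T : topologicalType) (h : T -> R) (f : T -> P) a :
  {for a, continuous h} -> {for a, continuous f} ->
  {for a, continuous (fun x => cscale (h x) (f x))}.
Proof.
move=> ch cf; apply: continuous_at_pair; (apply: cvgM; first exact: ch).
  exact: continuous_at_fst.
exact: continuous_at_snd.
Qed.

(** [f] may have no limit at [a]: its values are bounded where [h] is non-zero, so the factor
    tending to 0 squeezes the product. *)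
Lemma continuous_at_cscale0 (T : topologicalType) (h : T -> R) (f : T -> P) a :
  {for a, continuous h} -> h a = 0 ->
  (forall x, h x != 0 -> on_circle (f x)) ->
  {for a, continuous (fun x => cscale (h x) (f x))}.
Proof.
move=> ch ha f1.
have bound (k : T -> R) : (forall x, `|k x| <= `|h x|) -> {for a, continuous k}.
  move=> kh.
  have ka : k a = 0 by apply/eqP; rewrite -normr_le0; have := kh a; rewrite ha normr0.
  have ch0 : `|h x| @[x --> a] --> 0.
    by rewrite -(normr0 R) -ha; apply: cvg_norm.
  suff : k x @[x --> a] --> (0 : R) by rewrite -[X in _ --> X]ka.
  apply: norm_cvg0; apply: (squeeze_cvgr _ (cvg_cst 0) ch0).
  by apply: nearW => x; rewrite normr_ge0 kh.
have f1' x : h x != 0 -> `|(f x).1| <= 1 /\ `|(f x).2| <= 1.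
  move=> /f1 /circle_cis[t ->]; split; [exact: cos_max|exact: sin_max].
apply: continuous_at_pair; apply: bound => x; rewrite normrM;
  (have [->|/f1'[? ?]] := eqVneq (h x) 0; first by rewrite normr0 mul0r);
  exact: ler_piMr.
Qed.

Lemma dir0E (u : P) : cscale (enorm u) (dir (0, 0) u) = u.
Proof.
have [/enorm_eq0 ->|u0] := eqVneq (enorm u) 0.
  by rewrite /cscale /dir /= subrr !mul0r !mulr0.
rewrite /cscale /dir /dist2 !subr0 -surjective_pairing.
by rewrite !(mulrC (enorm u)) !divfK // -surjective_pairing.
Qed.

(** Outside a disc around [p] the field is [delta] times a unit field that has the direction of [V]
    on the boundary; inside, its length shrinks linearly to 0 at [p]. *)
Lemma single_zero_field (X : set P) (g : R -> P) (V : P -> P) (delta : R) p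
    (s : seq P) :
  closed X -> bounded_plane X -> Jordan_param g (boundary X) ->
  continuous V -> 0 < delta ->
  (forall x, boundary X x -> enorm (V x) = delta) ->
  (forall x, X x -> V x = (0, 0) -> x \in p :: s) ->
  (forall x, x \in p :: s -> X° x) -> uniq (p :: s) ->
  exists W : P -> P,
    [/\ {within X, continuous W}, forall x, X x -> enorm (W x) <= delta,
        forall x, boundary X x -> W x = V x
      & forall x, X x -> W x = (0, 0) <-> x = p].
Proof.
move=> clX bX gC cV d0 Vd Vs sX us.
have [r r0 [DX sep]] := disjoint_discs (@open_interior _ X) sX.
(* All zeros of [V] in [X] are centres of removed discs, so the direction of [V] is defined on what
   remains. *)
have V0 x : off_discs X r (p :: s) x -> V x <> (0, 0).
  move=> [Xx h] Vx0; have := h x (Vs _ Xx Vx0).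
  by rewrite dist2xx; lra.
have [|x Vx|U [cU U1 Ub]] :=
    fill_holes (U := dir (0, 0) \o V) clX bX gC r0 DX sep us.
- apply: continuous_in_subspaceT => x; rewrite inE => /V0 Vx.
  by apply: continuous_comp; [exact: cV|exact: continuous_dir].
- exact/dir_on_circle/V0.
set A := off_discs X r [:: p] in cU U1.
pose D := [set x : P | dist2 x p <= r].
have Ap x : A x -> r <= dist2 x p by move=> [_]; apply; rewrite mem_head.
have DXp x : D x -> X° x by apply: DX; rewrite mem_head.
have pX : X p by apply: interior_subset; apply: sX; rewrite mem_head.
have SA x : dist2 x p = r -> A x.
  move=> xp; split; first by apply: interior_subset; apply: DXp; rewrite /D /= xp.
  by move=> z; rewrite inE => /eqP ->; rewrite xp.
have XE : X = A `|` D.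
  rewrite eqEsubset; split=> x; last first.
    by move=> [[]//|/DXp]; exact: interior_subset.
  move=> Xx; have [xp|xp] := leP (dist2 x p) r; first by right.
  by left; split=> // z; rewrite inE => /eqP ->; exact: ltW.
have [k [Phi cPhi hPhi]] : exists k : int, exists2 Phi : P -> R, continuous Phi &
    forall x, dist2 x p = r -> U x = cmul (cpow (dir p x) k) (cis (Phi x)).
  by apply: circle_log => // [|x /SA]; [exact: continuous_subspaceW cU|exact: U1].
(* The factor is [delta] on the rim, matching the outer field, and 0 only at [p]. *)
pose h x := delta * (dist2 x p / r).
pose f x := cmul (cpow (dir p x) k) (cis (Phi x)).
pose W x := if x \in A then cscale delta (U x) else cscale (h x) (f x).
have WA x : A x -> cscale delta (U x) = W x.
  by move=> /mem_set xA; rewrite /W xA.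
have WD x : D x -> cscale (h x) (f x) = W x.
  rewrite /W; case: ifPn => //; rewrite inE => Ax Dx.
  have xp : dist2 x p = r by apply/eqP; rewrite eq_le Dx Ap.
  by rewrite /f -hPhi // /h xp divff ?mulr1 // gt_eqF.
have h0 x : h x != 0 -> x <> p.
  by move=> /eqP hx xp; apply: hx; rewrite /h xp dist2xx mul0r mulr0.
have hD x : D x -> 0 <= h x <= delta.
  move=> Dx; rewrite /h mulr_ge0 ?(ltW d0) ?divr_ge0 ?dist2_ge0 ?(ltW r0) //=.
  by rewrite ger_pMr // ler_pdivrMr // mul1r.
have f1 x : x <> p -> on_circle (f x).
  move=> xp; apply: on_circle_cmul; last exact: cis_on_circle.
  exact/on_circle_cpow/dir_on_circle.
have cf x : {for x, continuous (fun y => cscale (h y) (f y))}.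
  have ch : {for x, continuous h}.
    apply: cvgM; first exact: cvg_cst.
    by apply: cvgM; [exact: continuous_dist2|exact: cvg_cst].
  have [xp|/eqP xp] := eqVneq x p.
    apply: continuous_at_cscale0 => //; last by move=> y /h0; exact: f1.
    by rewrite /h xp dist2xx mul0r mulr0.
  apply: continuous_at_cscale => //; apply: continuous_at_cmul.
    by apply: continuous_at_cpow; exact: continuous_dir.
  exact/continuous_at_cis/cPhi.
have enormWA x : A x -> enorm (W x) = delta.
  by move=> Ax; rewrite -WA // enorm_cscale ?ltW //; exact: U1.
have enormWD x : D x -> enorm (W x) = h x.
  move=> Dx; have /andP[hx _] := hD _ Dx; rewrite -WD //.
  have [hx0|/h0 xp] := eqVneq (h x) 0; last by rewrite enorm_cscale //; exact: f1.
  by rewrite hx0 /cscale /enorm /= !mul0r expr0n addr0 sqrtr0.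
have enorm0 : enorm (0, 0) = 0 :> R by rewrite /enorm /= expr0n addr0 sqrtr0.
exists W; split.
- rewrite XE; apply: withinU_continuous; [exact: closed_off_discs|exact: closed_disc|..].
    apply: (within_eq WA) => x; apply: continuous_at_cscale; first exact: cvg_cst.
    exact: cU.
  by apply: (within_eq WD); exact: continuous_subspaceT.
- rewrite {1}XE => x [/enormWA -> //|Dx]; rewrite enormWD //.
  by case/andP: (hD _ Dx).
- move=> x bx; have [cXx nX] := bx.
  have Ax : A x.
    split=> [|z]; first by move: cXx; rewrite -(closure_id _).1.
    rewrite inE => /eqP ->; rewrite leNgt; apply/negP => xp.
    by apply: nX; apply: DXp; exact: ltW.
  (* On the boundary [V] has norm [delta], so [delta] times its direction is [V] itself. *)
  by rewrite -WA // Ub // -(Vd _ bx) /= dir0E.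
- rewrite {1}XE => x [Ax|Dx]; split.
  + by move=> Wx; move: d0; rewrite -(enormWA _ Ax) Wx enorm0 ltxx.
  + by move=> xp; have := Ap _ Ax; rewrite xp dist2xx leNgt r0.
  + move=> Wx; have := enormWD _ Dx; rewrite Wx enorm0 /h => /esym/eqP.
    rewrite mulf_eq0 (gt_eqF d0) /= mulf_eq0 invr_eq0 (gt_eqF r0) orbF.
    by move=> /eqP /dist2_eq0.
  + move=> xp; apply: enorm_eq0; rewrite enormWD // /h xp dist2xx.
    by rewrite mul0r mulr0.
Qed.

End SingleZero.

(* [\sum_(p \in A)] is [0] when infinitely many terms are nonzero. *)
Lemma degree_critical_seq (R : realType) (f : R * R -> R) (X : set (R * R)) :
  degree f X != 0 -> exists p s, uniq (p :: s) /\
    forall x, x \in p :: s <-> X x /\ critical f x.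
Proof.
(* Indices are never 0, so the support of the sum is the whole set of critical points in [X]. *)
have npi x : pindex f x != 0 by rewrite /pindex; case: ifP.
rewrite /degree => deg.
have fin : finite_set (X `&` critical f `&` pindex f @^-1` [set~ 0]).
  apply: contrapT => inf; move: deg.
  by rewrite (no_finite_support inf) big_nil eqxx.
move: deg; set L := finite_support _ _ _ => deg.
have mS : L =i X `&` critical f `&` pindex f @^-1` [set~ 0].
  exact: in_finite_support.
have : uniq L by exact: finite_support_uniq.
case: L deg mS => [|p s _ mS us]; first by rewrite big_nil eqxx.
exists p, s; split=> // x; rewrite mS inE.
by split=> [[]//|Xx]; split=> //; exact/eqP/npi.
Qed.

(** * Application to the gradient field *)

Theorem theorem3 (R : realType) (f : R * R -> R) (delta : R) (X : set (R * R)) :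
  smooth f -> morse f -> 0 < delta ->
  (exists x, enorm (grad f x) <= delta /\
     X = connected_component [set p | enorm (grad f p) <= delta] x) ->
  bounded_plane X -> simply_connected_plane X ->
  (forall p, closure X p -> enorm (grad f p) <= delta) ->
  (forall p, boundary X p -> enorm (grad f p) = delta) ->
  jordan_curve (boundary X) ->
  degree f X != 0 ->
  exists Vt : R * R -> R * R,
    {within closure X, continuous Vt} /\
    (forall p, closure X p -> dist2 (Vt p) (grad f p) <= 2 * delta) /\
    (forall p, boundary X p -> Vt p = grad f p) /\
    (exists! p, closure X p /\ Vt p = (0, 0)).
Proof.
move=> sf _ d0 [x0 [_ XE]] bX _ leX bdX [g [cg [g01 [ginj gE]]]].
move=> /degree_critical_seq[p [s [us ms]]].
have cgrad : continuous (grad f).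
  move=> x; apply: continuous_at_pair.
    exact: (proj1 (sf [:: true])).
  exact: (proj1 (sf [:: false])).
(* A connected component of a closed set is closed, so [X] is its own closure. *)
have clX : closed X.
  rewrite XE; apply: component_closed.
  have cn : continuous (fun x => enorm (grad f x)).
    by move=> x; apply: continuous_at_enorm; exact: cgrad.
  by have := @closed_le R delta; move/continuous_closedP: cn; exact.
have clXE : closure X = X by rewrite -(closure_id _).1.
have gC : Jordan_param g (boundary X) by split.
(* On the boundary the gradient has norm [delta > 0], so critical points of [X] are interior. *)
have sX x : x \in p :: s -> X° x.
  move=> /ms[Xx cx]; apply: contrapT => nX.
  have := bdX x; rewrite cx /boundary clXE /enorm /= expr0n addr0 sqrtr0 => d.
  by have := d (conj Xx nX); lra.
have zs x : X x -> grad f x = (0, 0) -> x \in p :: s.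
  by move=> Xx fx0; apply/ms.
have [W [cW Wd Wb W0]] := single_zero_field clX bX gC cgrad d0 bdX zs sX us.
rewrite clXE in leX *; exists W; split=> //; split.
  (* Both fields have norm at most [delta] on [X], whence the constant 2. *)
  move=> x Xx; rewrite /dist2.
  apply: le_trans (enorm_triangle (W x) (- (grad f x).1, - (grad f x).2)) _.
  have -> : enorm (- (grad f x).1, - (grad f x).2) = enorm (grad f x).
    by rewrite /enorm /= !sqrrN.
  by have := Wd _ Xx; have := leX _ Xx; lra.
split=> //; exists p; split.
  have pX : X p by apply: interior_subset; apply: sX; exact: mem_head.
  by split=> //; exact/W0.
by move=> x [Xx /(W0 _ Xx)].
Qed.
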